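(* Let $U$ be a finite ground set with $|U|=n$, $f:2^U\to\mathbb{R}_{\geq0}$ nonnegative, monotone and submodular, $\kappa$ a budget, and $\epsilon>0$. Let $OPT_{SM}\in\arg\max\{f(X):X\subseteq U,|X|\leq\kappa\}$. Then the algorithm \texttt{stoch-bi} (described in the context) makes $O(n\ln^2(\frac{3}{2\epsilon}))$ queries of $f$ and returns a set $S$ with $|S|\leq\ln(\frac{3}{2\epsilon})\kappa$ and $\mathbb{E}[f(S)]\geq(1-\epsilon)f(OPT_{SM})$; that is, it is a $(1-\epsilon,\ln(\frac{3}{2\epsilon}))$-bicriteria approximation algorithm for monotone submodular maximization under a cardinality constraint, with the factor $1-\epsilon$ holding in expectation.
   Context: A set function $f$ is submodular if $f(A\cup\{x\})-f(A)\geq f(B\cup\{x\})-f(B)$ for $A\subseteq B\subseteq U$, $x\notin B$, and monotone if $f(A)\leq f(B)$ for $A\subseteq B$. $\Delta f(S,u)=f(S\cup\{u\})-f(S)$. Algorithm \texttt{stoch-bi}(input $\epsilon$): set $S\gets\emptyset$. While $|S|<\ln(\frac{3}{2\epsilon})\kappa$: draw (independently) a uniformly random subset $R\subseteq U$ of $\frac{n}{\kappa}\ln(\frac{3}{2\epsilon})$ elements, let $u=\arg\max_{x\in R}\Delta f(S,x)$, and set $S\gets S\cup\{u\}$. Return $S$.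
   Formalization: As stated |S| ≤ ln(3/(2ε))κ fails by rounding and the loop may not end: the size bound is ⌈ln(3/(2ε))κ⌉, sample sizes are rounded up and capped at n, and the query bound is for ⌈ln(3/(2ε))κ⌉ passes, with κ ≤ n and ε ≤ ε0 for a fixed ε0 < 3/2. *)

(* Defs.v *)
From HB Require Import structures.
From mathcomp Require Import all_boot all_order all_algebra.
From mathcomp Require Import reals exp.

Set Implicit Arguments.
Unset Strict Implicit.
Unset Printing Implicit Defensive.

Import Order.TTheory GRing.Theory Num.Theory.
Local Open Scope ring_scope.

Definition monotone (R : realType) (U : finType) (f : {set U} -> R) : Prop :=
  forall A B : {set U}, A \subset B -> f A <= f B.

Definition marginal (R : realType) (U : finType) (f : {set U} -> R)
    (S : {set U}) (u : U) : R :=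
  f (u |: S) - f S.

Definition submodular (R : realType) (U : finType) (f : {set U} -> R) : Prop :=
  forall (A B : {set U}) (x : U),
    A \subset B -> x \notin B -> marginal f B x <= marginal f A x.

Definition is_opt (R : realType) (U : finType) (f : {set U} -> R)
    (kappa : nat) (X : {set U}) : Prop :=
  (#|X| <= kappa)%N /\ forall Y : {set U}, (#|Y| <= kappa)%N -> f Y <= f X.

(* [pick S A] is the element argmax_{x \in A} marginal f S x; ties are broken
   arbitrarily, and the result may lie in S if A meets S. *)
Definition argmax_rule (R : realType) (U : finType) (f : {set U} -> R)
    (pick : {set U} -> {set U} -> U) : Prop :=
  forall S A : {set U}, A != set0 ->
    pick S A \in A /\ forall x, x \in A -> marginal f S x <= marginal f S (pick S A).

(* Least natural number >= x; it is 0 when x <= 0. *)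
Definition natceil (R : realType) (x : R) : nat :=
  absz (Num.ceil (Num.max 0 x)).

Definition log_factor (R : realType) (eps : R) : R := ln (3 / (2 * eps)).

(* Size of a random sample, (n / kappa) ln (3 / (2 eps)), rounded up, and capped
   at n because the sample is a subset of the ground set. *)
Definition sample_size (R : realType) (n kappa : nat) (eps : R) : nat :=
  minn n (natceil (n%:R / kappa%:R * log_factor eps)).

(* State of the loop: the current set S, and the list of the sets at which f
   has been queried so far, repetitions included. *)
Definition state (U : finType) : Type := ({set U} * seq {set U})%type.

(* One pass of the while loop with sample A.  Finding the argmax queries f at S
   and at every S + x with x in A; once the guard fails, nothing changes. *)
Definition stoch_bi_pass (R : realType) (U : finType)
    (pick : {set U} -> {set U} -> U) (kappa : nat) (eps : R)
    (st : state U) (A : {set U}) : state U :=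
  let S := st.1 in
  if #|S|%:R < log_factor eps * kappa%:R
  then (pick S A |: S, st.2 ++ S :: [seq x |: S | x <- enum A])
  else st.

(* The while loop fed with the list [w] of samples.  Since a sample may lie
   inside S, a pass need not enlarge S and the unbounded loop need not terminate
   (nor can it if ln (3 / (2 eps)) * kappa > #|U|), hence the explicit list.
   If every pass enlarges S, the loop terminates after exactly
   [natceil (log_factor eps * kappa%:R)] passes. *)
Definition stoch_bi (R : realType) (U : finType)
    (pick : {set U} -> {set U} -> U) (kappa : nat) (eps : R)
    (w : seq {set U}) : state U :=
  foldl (stoch_bi_pass pick kappa eps) (set0, [::]) w.

Definition returned (U : finType) (st : state U) : {set U} := st.1.

Definition num_queries (U : finType) (st : state U) : nat := size st.2.

(* Outcomes of N draws of m-element subsets of U.  The uniform distribution on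
   this finite set is the law of N independent uniform m-element samples. *)
Definition draws (U : finType) (N m : nat) : {set N.-tuple {set U}} :=
  [set w : N.-tuple {set U} | all (fun A : {set U} => #|A| == m) w].

Definition expect_draws (R : realType) (U : finType) (N m : nat)
    (X : N.-tuple {set U} -> R) : R :=
  (\sum_(w in draws U N m) X w) / #|draws U N m|%:R.

(* Main.v *)
Require Import Defs.
From HB Require Import structures.
From mathcomp Require Import all_boot all_order all_algebra.
From mathcomp Require Import perm ring lra.
From mathcomp Require Import reals sequences exp.

Set Implicit Arguments.
Unset Strict Implicit.
Unset Printing Implicit Defensive.

Import Order.TTheory GRing.Theory Num.Theory.
Local Open Scope ring_scope.

(* Put L = ln (3 / (2 eps)) and delta = exp (- L) = 2 eps / 3.  A sample of size
   m >= (n / kappa) L misses OPT with probability at most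
   (1 - |OPT| / n) ^ m <= exp (- m |OPT| / n), so by concavity it hits OPT with
   probability at least (1 - delta) |OPT| / kappa.  Given a hit, by symmetry the
   chosen marginal is on average at least the mean of the marginals over OPT,
   which is at least (f OPT - f S) / |OPT| by submodularity.  Hence each pass
   shrinks the expected gap f OPT - f S by the factor 1 - (1 - delta) / kappa,
   and the first T >= L kappa passes, during which the guard cannot fail, leave
   at most exp (- (1 - delta) L) = delta exp (L exp (- L)) <= eps of the gap
   because x exp (- x) <= 1 / e <= ln (3 / 2). *)

(** * Rounding up to a natural number *)

Lemma le_natceil (R : realType) (x : R) : x <= (natceil x)%:R.
Proof.
rewrite /natceil natr_absz ger0_norm ?ceil_ge0; last first.
  by rewrite (lt_le_trans (ltrN10 _)) // le_max lexx.
by apply: le_trans (ceil_ge _); rewrite le_max lexx orbT.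
Qed.

Lemma natceil_lt (R : realType) (x : R) : 0 <= x -> (natceil x)%:R < x + 1.
Proof.
move=> x0; rewrite /natceil (max_idPr x0) natr_absz ger0_norm; last first.
  by rewrite ceil_ge0 (lt_le_trans (ltrN10 _)).
by have := ceilB1_lt x; rewrite intrB -ltrBlDr.
Qed.

(** Turns the loop guard, a comparison of reals, into a comparison of natural numbers. *)
Lemma lt_natceil (R : realType) (x : R) (k : nat) :
  (k < natceil x)%N = (k%:R < x).
Proof.
have x0 : 0 <= Num.ceil (Num.max 0 x).
  by rewrite ceil_ge0 (lt_le_trans (ltrN10 _)) // le_max lexx.
rewrite /natceil -ltz_nat gez0_abs // ceil_gt_int -pmulrn lt_max.
by rewrite ltNge ler0n.
Qed.

(** * Marginals and greedy choices *)

Lemma marginal_ge0 (R : realType) (U : finType) (f : {set U} -> R)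
    (S : {set U}) (x : U) : monotone f -> 0 <= marginal f S x.
Proof. by move=> mf; rewrite subr_ge0; apply/mf/subsetUr. Qed.

(** Elements [a] leave [X] one at a time: by submodularity the marginal of [a] over [S :|: X :\ a]
    is at most its marginal over [S]. *)
Lemma submodular_union_le (R : realType) (U : finType) (f : {set U} -> R)
    (S X : {set U}) :
  submodular f -> f (S :|: X) - f S <= \sum_(x in X) marginal f S x.
Proof.
move=> sf; move: {2}#|X| (leqnn #|X|) => n.
elim: n X => [|n IH] X.
  by rewrite leqn0 cards_eq0 => /eqP->; rewrite big_set0 setU0 subrr.
have [->|[a aX]] := set_0Vmem X; first by rewrite big_set0 setU0 subrr.
rewrite (cardsD1 a) aX ltnS => /IH {}IH.
rewrite (big_setD1 a) //= -lerBlDl; apply: le_trans IH.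
have -> : S :|: X = a |: (S :|: X :\ a) by rewrite setUCA setD1K.
suff: marginal f (S :|: X :\ a) a <= marginal f S a by rewrite /marginal; lra.
(* Submodularity speaks only of [a] outside the larger set. Otherwise [a] lies in [S] and both
   marginals vanish. *)
have [aS|aS] := boolP (a \in S :|: X :\ a).
  have aS' : a \in S by move: aS; rewrite !inE eqxx orbF.
  rewrite /marginal (setUidPr (_ : [set a] \subset _)) ?sub1set //.
  by rewrite (setUidPr (_ : [set a] \subset S)) ?sub1set // !subrr.
by apply: sf => //; apply: subsetUl.
Qed.

(* Averaging the marginals over [A :&: X] for the samples [A] that meet [X]
   gives every element of [X] the same weight, by symmetry. *)
Lemma sum_hits_weight (R : realType) (U : finType) (X : {set U}) (m : nat)
    (g : U -> R) :
  #|X|%:R * \sum_(A : {set U} | (#|A| == m) && (A :&: X != set0))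
     (\sum_(x in A :&: X) g x) / #|A :&: X|%:R
  = #|[set A : {set U} | (#|A| == m) && (A :&: X != set0)]|%:R
      * \sum_(x in X) g x.
Proof.
pose P (A : {set U}) := (#|A| == m) && (A :&: X != set0).
(* The total weight that [x] receives from all samples of size [m] containing it. *)
pose c x : R := \sum_(A | P A && (x \in A)) #|A :&: X|%:R^-1.
have sumE h : \sum_(A | P A) (\sum_(x in A :&: X) h x) / #|A :&: X|%:R
              = \sum_(x in X) h x * c x.
  under eq_bigr => A _ do rewrite mulr_suml.
  rewrite (exchange_big_dep (mem X)) /=; last by move=> A x _; rewrite inE => /andP[].
  apply: eq_bigr => x xX; rewrite mulr_sumr; apply: eq_bigl => A.
  by rewrite inE xX andbT.
(* Transposing [x] and [y] fixes [X] and permutes the samples that meet it, exchanging the two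
   weights. *)
have cE x y : x \in X -> y \in X -> c x = c y.
  move=> xX yX; rewrite /c.
  have invS : involutive (fun A : {set U} => tperm x y @: A).
    move=> A; rewrite -imset_comp -[RHS]imset_id; apply: eq_imset => z /=.
    by rewrite tpermK.
  have SX : tperm x y @: X = X.
    apply/eqP; rewrite eqEcard card_imset ?leqnn ?andbT; last exact: perm_inj.
    by apply/subsetP=> _ /imsetP[z zX ->]; case: tpermP => // ->.
  have SI (A : {set U}) : (tperm x y @: A) :&: X = tperm x y @: (A :&: X).
    by rewrite imsetI ?SX // => ? ? _ _; apply: perm_inj.
  have SC (A : {set U}) : #|tperm x y @: A| = #|A| by apply/card_imset/perm_inj.
  rewrite (reindex_inj (inv_inj invS)) /=; apply: eq_big => A; last by rewrite SI SC.
  rewrite /P SI -!card_gt0 !SC; congr (_ && _).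
  by rewrite -{1}(tpermR x y) mem_imset //; apply: perm_inj.
rewrite sumE.
have [->|[a aX]] := set_0Vmem X; first by rewrite !big_set0 !mulr0.
under eq_bigr => x xX do rewrite (cE x a) //.
rewrite -mulr_suml mulrCA mulrC; congr (_ * _).
(* The common weight is read off from the case where [g] is constantly 1: each sample that meets [X]
   then contributes exactly 1. *)
have -> : #|X|%:R * c a = \sum_(x in X) 1 * c x.
  under [RHS]eq_bigr => x xX do rewrite mul1r (cE x a) //.
  by rewrite sumr_const mulr_natl.
rewrite -sumE -sum1dep_card natr_sum; apply: eq_big => // A /andP[_ A0].
by rewrite sumr_const divff // pnatr_eq0 cards_eq0.
Qed.

(** On a sample that meets [X], the chosen marginal is at least the mean of the marginals over
    [A :&: X]; samples that miss [X] contribute nonnegative terms. Counts replace probabilities. *)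
Lemma greedy_gain (R : realType) (U : finType) (f : {set U} -> R)
    (pick : {set U} -> {set U} -> U) (S X : {set U}) (m : nat) :
  monotone f -> submodular f -> argmax_rule f pick ->
  #|[set A : {set U} | (#|A| == m) && (A :&: X != set0)]|%:R * (f X - f S)
    <= #|X|%:R * \sum_(A : {set U} | #|A| == m) marginal f S (pick S A).
Proof.
move=> mf sf pf.
apply: (@le_trans _ _
  (#|[set A : {set U} | (#|A| == m) && (A :&: X != set0)]|%:R
     * \sum_(x in X) marginal f S x)).
  rewrite ler_wpM2l //; apply: le_trans (submodular_union_le S X sf).
  by rewrite lerB // mf // subsetUr.
rewrite -sum_hits_weight ler_wpM2l //.
rewrite [leRHS](bigID (fun A => A :&: X != set0)) /= -[leLHS]addr0 lerD //.
  apply: ler_sum => A /andP[_ A0].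
  have AXp : 0 < #|A :&: X|%:R :> R by rewrite ltr0n card_gt0.
  rewrite ler_pdivrMr //.
  have Ane : A != set0 by apply: contraNneq A0 => ->; rewrite set0I.
  have [_ pmax] := pf S A Ane.
  apply: (@le_trans _ _ (\sum_(x in A :&: X) marginal f S (pick S A))).
    by apply: ler_sum => x; rewrite inE => /andP[xA _]; apply: pmax.
  by rewrite sumr_const mulr_natr.
by apply: sumr_ge0 => A _; apply: marginal_ge0.
Qed.

(** * Probability that a sample meets a given set *)

Lemma card_misses (U : finType) (X : {set U}) (m : nat) :
  #|[set A : {set U} | (#|A| == m) && (A :&: X == set0)]| = 'C(#|U| - #|X|, m).
Proof.
have -> : (#|U| - #|X|)%N = #|~: X| by rewrite [RHS]cardsCs setCK.
rewrite -cards_draws; apply: eq_card => A; rewrite !inE andbC.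
by rewrite setI_eq0 disjoints_subset.
Qed.

(** Sampling without replacement misses [s] given elements no more often than sampling with
    replacement: factor by factor, [(n - s - i) * n <= (n - i) * (n - s)]. *)
Lemma bin_ratio_le (n s m : nat) :
  (s <= n)%N -> ('C(n - s, m) * n ^ m <= 'C(n, m) * (n - s) ^ m)%N.
Proof.
move=> sn; rewrite -(leq_pmul2l (fact_gt0 m)) !mulnA ![(m`! * _)%N]mulnC !bin_ffact.
elim: m => [|m IH]; first by rewrite !expn0.
rewrite !ffactnSr !expnSr mulnACA [leqRHS]mulnACA leq_mul //.
by rewrite [leqLHS]mulnBl [leqRHS]mulnBl [(n * _)%N]mulnC leq_sub2l //
  leq_mul2l leq_subr orbT.
Qed.

(** Discrete concavity of [s] to [1 - q ^+ s]: chords from the origin get flatter. *)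
Lemma exp_chord (R : realType) (q : R) (s k : nat) :
  0 <= q <= 1 -> (s <= k)%N -> s%:R * (1 - q ^+ k) <= k%:R * (1 - q ^+ s).
Proof.
move=> /andP[q0 q1]; elim: k => [|k IH]; first by rewrite leqn0 => /eqP->.
rewrite leq_eqVlt => /predU1P[->//|sk]; have {}IH := IH sk.
(* The increment at [k] is at most each of the first [s] increments, which add up to
   [1 - q ^+ s]. *)
have qs : s%:R * ((1 - q) * q ^+ k) <= 1 - q ^+ s.
  rewrite -[leRHS]opprB subrX1 -mulNr opprB mulrCA ler_wpM2l ?subr_ge0 //.
  rewrite -[s in s%:R]card_ord mulr_natl -sumr_const; apply: ler_sum => i _.
  by apply: ler_wiXn2l => //; apply/ltnW/(leq_trans (ltn_ord i)).
rewrite exprS -natr1 mulrDl mul1r.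
apply: le_trans (lerD IH qs); rewrite -mulrDr ler_wpM2l //; lra.
Qed.

Lemma expRN_log_factor (R : realType) (eps : R) :
  0 < eps -> expR (- log_factor eps) = 2 / 3 * eps.
Proof.
move=> e0; rewrite expRN lnK; last by rewrite posrE divr_gt0 // mulr_gt0.
by rewrite invf_div mulrAC.
Qed.

Lemma log_factor_gt0 (R : realType) (eps : R) :
  0 < eps -> (0 < log_factor eps) = (eps < 3 / 2).
Proof.
by move=> e0; rewrite -oppr_lt0 -expR_lt1 expRN_log_factor //; apply/idP/idP => ?; lra.
Qed.

Lemma sample_hits (R : realType) (U : finType) (X : {set U}) (k : nat)
    (eps : R) (m := sample_size #|U| k eps) :
  0 < eps -> 0 < log_factor eps -> (#|X| <= k)%N ->
  'C(#|U|, m)%:R * ((1 - 2 / 3 * eps) * #|X|%:R)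
    <= k%:R * #|[set A : {set U} | (#|A| == m) && (A :&: X != set0)]|%:R :> R.
Proof.
move=> e0 L0 Xk.
have mn : (m <= #|U|)%N by apply: geq_minl.
have [->|] := posnP #|X|; first by rewrite !mulr0 mulr_ge0.
move=> X0; have k0 := leq_trans X0 Xk; have sn : (#|X| <= #|U|)%N := max_card _.
have n0 := leq_trans X0 sn.
have dlt1 : 2 / 3 * eps < 1 by move: L0; rewrite log_factor_gt0 //; lra.
have hitE : 'C(#|U|, m)%:R = 'C(#|U| - #|X|, m)%:R
    + #|[set A : {set U} | (#|A| == m) && (A :&: X != set0)]|%:R :> R.
  rewrite -natrD -card_misses -card_draws; congr _%:R.
  rewrite -(cardsID [set A | A :&: X == set0]); congr (_ + _)%N; apply: eq_card => A;
    by rewrite !inE // andbC.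
set h := #|_|%:R in hitE *.
have n0R : 0 < #|U|%:R :> R by rewrite ltr0n.
have k0R : 0 < k%:R :> R by rewrite ltr0n.
have XkR : #|X|%:R <= k%:R :> R by rewrite ler_nat.
have C0 : 0 <= 'C(#|U|, m)%:R :> R by [].
(* If the cap is reached, the sample is all of [U] and meets the nonempty [X]. *)
have [nm|nm] := leqP #|U| m.
  have hC : h = 'C(#|U|, m)%:R.
    rewrite hitE bin_small ?add0r //; apply: leq_trans nm.
    by rewrite ltn_subrL X0.
  rewrite hC mulrC ler_wpM2r //; apply: le_trans XkR.
  by rewrite ler_piMl //; lra.
(* A set of [s] elements is missed with probability at most [q ^+ s], and the choice of [m] makes
   [q ^+ k] at most [2 / 3 * eps]. The chord inequality then passes from [k] to [#|X|]. *)
pose q : R := expR (- (m%:R / #|U|%:R)).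
have qX j : q ^+ j = expR (- (j%:R * m%:R / #|U|%:R)).
  by rewrite -expRM_natl mulrN mulrA.
have q01 : 0 <= q <= 1.
  by rewrite expR_ge0 expR_le1 oppr_le0 divr_ge0.
have qk : q ^+ k <= 2 / 3 * eps.
  rewrite qX -expRN_log_factor // ler_expR lerN2.
  have : #|U|%:R / k%:R * log_factor eps <= m%:R.
    move: nm; rewrite {1}/m /sample_size gtn_min ltnn /= => nm.
    rewrite /m /sample_size (minn_idPr (ltnW nm)); apply: le_natceil.
  by rewrite ler_pdivlMr // mulrAC ler_pdivrMr // mulrC [m%:R * _]mulrC.
have qs : 'C(#|U| - #|X|, m)%:R <= 'C(#|U|, m)%:R * q ^+ #|X|.
  have nm0 : 0 < #|U|%:R ^+ m :> R by apply: exprn_gt0.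
  rewrite -(ler_pM2r nm0) -natrX -natrM.
  apply: (@le_trans _ _ ('C(#|U|, m) * (#|U| - #|X|) ^ m)%:R).
    by rewrite ler_nat bin_ratio_le.
  rewrite natrM -mulrA ler_wpM2l // !natrX.
  have -> : q ^+ #|X| = expR (- (#|X|%:R / #|U|%:R)) ^+ m.
    by rewrite qX -expRM_natl; congr expR; rewrite mulrN mulrA [m%:R * _]mulrC.
  rewrite -exprMn lerXn2r ?nnegrE ?mulr_ge0 ?expR_ge0 //.
  apply: (@le_trans _ _ ((1 + - (#|X|%:R / #|U|%:R)) * #|U|%:R)); last first.
    by rewrite ler_wpM2r // expR_ge1Dx.
  by rewrite natrB // mulrBl mul1r divfK // gt_eqF.
have -> : h = 'C(#|U|, m)%:R - 'C(#|U| - #|X|, m)%:R by rewrite hitE addrC addKr.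
apply: (@le_trans _ _ (k%:R * ('C(#|U|, m)%:R * (1 - q ^+ #|X|)))); last first.
  by rewrite ler_wpM2l // mulrBr mulr1 lerB.
rewrite [leRHS]mulrCA ler_wpM2l //; apply: le_trans (exp_chord q01 Xk).
by rewrite mulrC ler_wpM2l // lerB.
Qed.

(** * Expected gain of one pass *)

(** Combines the greedy gain with the hitting bound and cancels [#|X|]. When the gap is positive,
    monotonicity forces [X] to be nonempty; otherwise the left side is at most 0. *)
Lemma pass_gain (R : realType) (U : finType) (f : {set U} -> R)
    (pick : {set U} -> {set U} -> U) (S X : {set U}) (k : nat) (eps : R)
    (m := sample_size #|U| k eps) :
  monotone f -> submodular f -> argmax_rule f pick ->
  0 < eps -> 0 < log_factor eps -> (#|X| <= k)%N ->
  'C(#|U|, m)%:R * ((1 - 2 / 3 * eps) * (f X - f S))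
    <= k%:R * \sum_(A : {set U} | #|A| == m) marginal f S (pick S A).
Proof.
move=> mf sf pf e0 L0 Xk.
have dlt1 : 2 / 3 * eps < 1 by move: L0; rewrite log_factor_gt0 //; lra.
have sum0 : 0 <= \sum_(A : {set U} | #|A| == m) marginal f S (pick S A).
  by apply: sumr_ge0 => A _; apply: marginal_ge0.
have [D0|D0] := leP (f X - f S) 0.
  apply: (@le_trans _ _ 0); last exact: mulr_ge0.
  by rewrite mulr_ge0_le0 // mulr_ge0_le0 //; lra.
have X0 : 0 < #|X|%:R :> R.
  rewrite ltr0n card_gt0; apply: contraTneq D0 => ->.
  by rewrite -leNgt subr_le0 mf ?sub0set.
rewrite -(ler_pM2l X0) [leRHS]mulrCA.
apply: le_trans (ler_wpM2l _ (greedy_gain S X m mf sf pf)) => //.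
have := ler_wpM2r (ltW D0) (sample_hits e0 L0 Xk).
rewrite -!mulrA !(mulrA k%:R) => H; apply: le_trans H.
by rewrite [leLHS]mulrCA ![#|X|%:R * _]mulrCA.
Qed.

(** * Sums over sequences of draws *)

Lemma sum_draws0 (V : nmodType) (U : finType) (m : nat)
    (X : 0.-tuple {set U} -> V) :
  \sum_(w in draws U 0 m) X w = X [tuple].
Proof.
by rewrite (big_pred1 [tuple]) // => w; rewrite inE tuple0 /= eqxx.
Qed.

Lemma sum_draws_cons (V : nmodType) (U : finType) (N m : nat)
    (X : N.+1.-tuple {set U} -> V) :
  \sum_(w in draws U N.+1 m) X w
  = \sum_(A : {set U} | #|A| == m) \sum_(w in draws U N m) X [tuple of A :: w].
Proof.
rewrite pair_big /=.
rewrite (reindex (fun p : {set U} * N.-tuple {set U} => [tuple of p.1 :: p.2])) /=.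
  by apply: eq_bigl => -[A w]; rewrite !inE.
exists (fun w => (thead w, [tuple of behead w])) => [[A w]|w] _.
  by congr pair; apply/val_inj.
by rewrite [RHS]tuple_eta; apply/val_inj.
Qed.

Lemma card_draws_expn (U : finType) (N m : nat) :
  #|draws U N m| = ('C(#|U|, m) ^ N)%N.
Proof.
apply/eqP; rewrite -(eqr_nat rat); apply/eqP.
elim: N => [|N IH]; rewrite -sum1_card natr_sum.
  exact: (sum_draws0 m (fun=> 1%:R)).
apply: etrans (sum_draws_cons m (fun=> 1%:R)) _.
under eq_bigr => A _ do rewrite -natr_sum sum1_card IH.
rewrite -card_draws sumr_const expnS natrM mulr_natl; congr (_ *+ _).
by apply: eq_card => A; rewrite inE.
Qed.

(** * Bounds valid for every sequence of samples *)

Lemma le_stoch_bi_fold (R : realType) (U : finType) (f : {set U} -> R)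
    (pick : {set U} -> {set U} -> U) (k : nat) (eps : R) (st : state U)
    (w : seq {set U}) :
  monotone f -> f st.1 <= f (foldl (stoch_bi_pass pick k eps) st w).1.
Proof.
move=> mf; elim: w st => //= A w IH st; apply: le_trans (IH _).
by rewrite /stoch_bi_pass; case: ifP => // _; apply/mf/subsetUr.
Qed.

(** A pass adds at most one element, and only while the guard gives [#|S| < T]. *)
Lemma card_stoch_bi_fold (R : realType) (U : finType)
    (pick : {set U} -> {set U} -> U) (k : nat) (eps : R) (st : state U)
    (w : seq {set U}) (T := natceil (log_factor eps * k%:R)) :
  (#|st.1| <= T -> #|(foldl (stoch_bi_pass pick k eps) st w).1| <= T)%N.
Proof.
elim: w st => //= A w IH st stT; apply: IH.
rewrite /stoch_bi_pass; case: ifP => //=; rewrite -lt_natceil -/T => stlt.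
by apply: leq_trans stlt; rewrite cardsU1 -add1n leq_add2r leq_b1.
Qed.

Lemma size_queries_stoch_bi_fold (R : realType) (U : finType)
    (pick : {set U} -> {set U} -> U) (k m : nat) (eps : R) (st : state U)
    (w : seq {set U}) :
  all (fun A : {set U} => #|A| == m) w ->
  (size (foldl (stoch_bi_pass pick k eps) st w).2
    <= size st.2 + size w * m.+1)%N.
Proof.
elim: w st => [|A w IH] st /=; first by rewrite addn0.
move=> /andP[/eqP Am /IH{}IH]; apply: leq_trans (IH _) _.
rewrite mulSn addnA leq_add2r /stoch_bi_pass; case: ifP => _ /=; last exact: leq_addr.
by rewrite size_cat /= size_map -cardE Am.
Qed.

(** * Expected gap after several passes *)

(** Induction on [N], conditioning on the first draw. The bound on [#|st.1| + j] keeps the guard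
    true for [j] passes, each shrinking the gap by [rho]; the other passes cannot decrease [f]. *)
Lemma stoch_bi_fold_expect (R : realType) (U : finType) (f : {set U} -> R)
    (pick : {set U} -> {set U} -> U) (X : {set U}) (k N j : nat) (eps : R)
    (st : state U) (m := sample_size #|U| k eps)
    (rho := 1 - (1 - 2 / 3 * eps) / k%:R) :
  monotone f -> submodular f -> argmax_rule f pick ->
  0 < eps -> 0 < log_factor eps -> (0 < k)%N -> (#|X| <= k)%N -> (j <= N)%N ->
  (#|st.1| + j <= natceil (log_factor eps * k%:R))%N ->
  'C(#|U|, m)%:R ^+ N * (f X - rho ^+ j * (f X - f st.1))
  <= \sum_(w in draws U N m) f (foldl (stoch_bi_pass pick k eps) st w).1.
Proof.
move=> mf sf pf e0 L0 k0 Xk.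
have dlt1 : 2 / 3 * eps < 1 by move: L0; rewrite log_factor_gt0 //; lra.
have k0R : 0 < k%:R :> R by rewrite ltr0n.
have C0 : 0 <= 'C(#|U|, m)%:R :> R by [].
have rho0 : 0 <= rho.
  rewrite subr_ge0 ler_pdivrMr // mul1r.
  have : 1 <= k%:R :> R by rewrite ler1n.
  lra.
elim: N j st => [|N IH] [|j] st // jN stT.
- by rewrite sum_draws0 !expr0 !mul1r opprB addrC subrK.
- rewrite expr0 mul1r opprB addrC subrK -natrX -card_draws_expn.
  rewrite mulr_natl -sumr_const; apply: ler_sum => w _.
  exact: le_stoch_bi_fold.
rewrite sum_draws_cons /=.
have guard : #|st.1|%:R < log_factor eps * k%:R.
  by rewrite -lt_natceil; apply: leq_trans stT; rewrite addnS ltnS leq_addr.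
pose S' A := pick st.1 A |: st.1.
apply: (@le_trans _ _ (\sum_(A : {set U} | #|A| == m)
    'C(#|U|, m)%:R ^+ N * (f X - rho ^+ j * (f X - f (S' A))))); last first.
  apply: ler_sum => A _.
  have -> : S' A = (stoch_bi_pass pick k eps st A).1 by rewrite /stoch_bi_pass guard.
  apply: IH => //; rewrite /stoch_bi_pass guard /=.
  apply: leq_trans stT; rewrite addnS -addSn leq_add2r cardsU1 -add1n.
  by rewrite leq_add2r leq_b1.
rewrite -mulr_sumr exprSr -mulrA ler_wpM2l ?exprn_ge0 //.
have constE (x : R) : \sum_(A : {set U} | #|A| == m) x = 'C(#|U|, m)%:R * x.
  rewrite sumr_const mulr_natl -card_draws; congr (_ *+ _).
  by apply: eq_card => A; rewrite inE.
have -> : \sum_(A : {set U} | #|A| == m) (f X - rho ^+ j * (f X - f (S' A)))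
    = 'C(#|U|, m)%:R * (f X - rho ^+ j * (f X - f st.1))
      + rho ^+ j * \sum_(A : {set U} | #|A| == m) marginal f st.1 (pick st.1 A).
  rewrite -constE mulr_sumr -big_split /=; apply: eq_bigr => A _.
  by rewrite /marginal /S'; ring.
have := ler_wpM2l (exprn_ge0 j rho0) (pass_gain st.1 mf sf pf e0 L0 Xk).
rewrite -/m; set g := \sum_(_ | _) _ => H.
rewrite -lerBlDl -(ler_pM2l k0R) [leRHS]mulrCA; apply: le_trans H.
(* The two sides are equal, since [k * (1 - rho) = 1 - 2 / 3 * eps]. *)
rewrite le_eqVlt; apply/orP; left; apply/eqP.
by rewrite exprSr /rho; field; rewrite gt_eqF.
Qed.

(** * Numerical estimate of the decay *)

Lemma expR_mul_expRN_le (R : realType) (x : R) : expR (x * expR (- x)) <= 3 / 2.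
Proof.
(* The bound [1 + t <= exp t] at [t = 1 / 32], raised to the power 32, gives about 2.677. *)
have e1 : 265 / 100 <= expR 1 :> R.
  have -> : expR 1 = expR (1 / 32) ^+ 32 :> R.
    by rewrite -expRM_natl; congr expR; lra.
  apply: (@le_trans _ _ ((33 / 32) ^+ 32)); first by lra.
  rewrite lerXn2r ?nnegrE ?expR_ge0 //; first by lra.
  by apply: le_trans (expR_ge1Dx _); lra.
have xe : x * expR (- x) <= 100 / 265.
  have : x <= expR (x - 1) by have := expR_ge1Dx (x - 1); lra.
  rewrite expRD !expRN ler_pdivlMr ?expR_gt0 // ler_pdivrMr ?expR_gt0 // => H.
  have [x0|x0] := leP x 0; first by have := expR_gt0 x; lra.
  have := ler_wpM2l (ltW x0) e1; lra.
move: (x * _) xe => y xe.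
rewrite -[y]opprK expRN -[leRHS]invrK lef_pV2 ?posrE ?expR_gt0 ?invr_gt0
  ?divr_gt0 //.
(* Cutting the exponent into three sharpens [1 + t <= exp t] just enough: [(1 - 100 / 795) ^+ 3]
   exceeds 2 / 3. *)
have -> : - y = 3%:R * (- (y / 3)) by lra.
rewrite expRM_natl.
apply: (@le_trans _ _ ((1 - 100 / 795) ^+ 3)); first by rewrite invf_div; lra.
rewrite lerXn2r ?nnegrE ?expR_ge0 //; first by lra.
by apply: le_trans (expR_ge1Dx _); lra.
Qed.

(** With [d = exp (- L) = 2 / 3 * eps], the power is at most [exp (- (1 - d) L) = d * exp (L d)];
    the factor 3 / 2 inside the logarithm pays for [exp (L d)]. *)
Lemma decay_le (R : realType) (eps : R) (k T : nat) :
  0 < eps -> 0 < log_factor eps -> (0 < k)%N -> log_factor eps * k%:R <= T%:R ->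
  (1 - (1 - 2 / 3 * eps) / k%:R) ^+ T <= eps.
Proof.
move=> e0 L0 k0 LT; set L := log_factor eps in L0 LT *.
have dE : 2 / 3 * eps = expR (- L) by rewrite expRN_log_factor.
have d1 : expR (- L) < 1 by rewrite expR_lt1 oppr_lt0.
have k1 : 1 <= k%:R :> R by rewrite ler1n.
have k0R : 0 < k%:R :> R by rewrite ltr0n.
rewrite dE; set d := expR (- L) in dE d1 *.
apply: (@le_trans _ _ (expR (- ((1 - d) / k%:R)) ^+ T)).
  rewrite lerXn2r ?nnegrE ?expR_ge0 ?expR_ge1Dx //.
  by rewrite subr_ge0 ler_pdivrMr // mul1r; have := expR_gt0 (- L); rewrite -/d; lra.
apply: (@le_trans _ _ (expR (- ((1 - d) * L)))).
  rewrite -expRM_natl ler_expR mulrN lerN2 mulrA ler_pdivlMr //.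
  by rewrite -mulrA [leRHS]mulrC ler_wpM2l // subr_ge0 ltW.
have -> : - ((1 - d) * L) = L * d + - L by ring.
rewrite expRD -/d.
have := expR_mul_expRN_le L; rewrite -/d => H.
have := ler_wpM2r (expR_ge0 (- L)) H; rewrite -/d -dE; lra.
Qed.

(** * Number of queries *)

(** The product is at most [(L k + 1) (n L / k + 2)], by rounding and the extra query at [S] in each
    pass. Lower-order terms are absorbed through [1 <= L / L0] and [1 <= k <= n]; for [k = 0] there
    is no pass. *)
Lemma num_queries_le (R : realType) (n k : nat) (eps L0 : R)
    (L := log_factor eps) :
  0 < L0 -> L0 <= L -> (k <= n)%N ->
  (natceil (L * k%:R) * (sample_size n k eps).+1)%:R
    <= (1 + 3 / L0 + 2 / L0 ^+ 2) * (n%:R * L ^+ 2).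
Proof.
move=> L00 LL kn; have Lp : 0 < L := lt_le_trans L00 LL.
have [->|k0] := posnP k.
  have -> : natceil (L * 0%:R) = 0%N.
    by apply/eqP; rewrite -leqn0 leqNgt lt_natceil mulr0 ltxx.
  rewrite mul0n mulr_ge0 ?mulr_ge0 ?exprn_ge0 ?(ltW Lp) //.
  by rewrite !addr_ge0 ?divr_ge0 ?exprn_ge0 ?(ltW L00).
have k1 : 1 <= k%:R :> R by rewrite ler1n.
have k0R : 0 < k%:R :> R by rewrite ltr0n.
have knR : k%:R <= n%:R :> R by rewrite ler_nat.
have TL : (natceil (L * k%:R))%:R <= L * k%:R + 1.
  by apply/ltW/natceil_lt/mulr_ge0 => //; apply: ltW.
have mL : (sample_size n k eps).+1%:R <= n%:R / k%:R * L + 2.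
  rewrite -natr1; have : (sample_size n k eps)%:R <= (natceil (n%:R / k%:R * L))%:R :> R.
    by rewrite ler_nat geq_minr.
  have : 0 <= n%:R / k%:R * L by rewrite mulr_ge0 ?(ltW Lp) // divr_ge0.
  by move=> /natceil_lt; lra.
rewrite natrM; apply: le_trans (ler_pM _ _ TL mL) _ => //.
have -> : (L * k%:R + 1) * (n%:R / k%:R * L + 2)
    = n%:R * L ^+ 2 + 2 * (L * k%:R) + n%:R / k%:R * L + 2.
  by field; rewrite gt_eqF.
have nk : n%:R / k%:R * L <= n%:R * L.
  by rewrite ler_wpM2r ?(ltW Lp) // ler_pdivrMr // ler_peMr.
have Lk : L * k%:R <= n%:R * L by rewrite mulrC ler_wpM2r ?(ltW Lp).
have q1 : 1 <= L / L0 by rewrite ler_pdivlMr // mul1r.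
have H1 : n%:R * L <= n%:R * L * (L / L0).
  by rewrite ler_peMr // mulr_ge0 // ltW.
have H2 : 1 <= n%:R * (L / L0) ^+ 2.
  by rewrite mulr_ege1 ?exprn_ege1 //; apply: le_trans k1 knR.
have -> : (1 + 3 / L0 + 2 / L0 ^+ 2) * (n%:R * L ^+ 2)
    = n%:R * L ^+ 2 + 3 * (n%:R * L * (L / L0)) + 2 * (n%:R * (L / L0) ^+ 2).
  by field; rewrite gt_eqF.
lra.
Qed.

Theorem theorem7 (R : realType) (eps0 : R) (eps0_lt : eps0 < 3 / 2) :
  exists C : R, 0 < C /\
  forall (U : finType) (f : {set U} -> R) (kappa : nat) (eps : R)
         (pick : {set U} -> {set U} -> U) (OPT : {set U}),
    (forall X : {set U}, 0 <= f X) ->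
    monotone f ->
    submodular f ->
    0 < eps ->
    argmax_rule f pick ->
    is_opt f kappa OPT ->
    let m := sample_size #|U| kappa eps in
    let T := natceil (log_factor eps * kappa%:R) in
    [/\ (kappa <= #|U|)%N -> eps <= eps0 ->
          forall w : T.-tuple {set U}, w \in draws U T m ->
            (num_queries (stoch_bi pick kappa eps w))%:R
              <= C * (#|U|%:R * log_factor eps ^+ 2),
        forall N : nat, (T <= N)%N ->
          forall w : N.-tuple {set U}, w \in draws U N m ->
            (#|returned (stoch_bi pick kappa eps w)| <= T)%N
      & forall N : nat, (T <= N)%N ->
          (1 - eps) * f OPT
            <= expect_draws m
                 (fun w : N.-tuple {set U} =>
                    f (returned (stoch_bi pick kappa eps w)))].
Proof.
set L0 := log_factor eps0.
have L0_gt0 : 0 < eps0 -> 0 < L0 by move=> e0; rewrite log_factor_gt0.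
(* If [eps0 <= 0], no [eps] satisfies [0 < eps <= eps0], and 1 is a default value. *)
pose C : R := if 0 < eps0 then 1 + 3 / L0 + 2 / L0 ^+ 2 else 1.
exists C; split.
  rewrite /C; case: ifP => // /L0_gt0 L0p.
  by rewrite !addr_gt0 ?divr_gt0 ?exprn_gt0.
move=> U f k eps pick OPT f0 mf sf e0 pf [cOPT _] m T; split.
- move=> kn ele w; rewrite inE => /(size_queries_stoch_bi_fold pick k eps (set0, [::])).
  have ep := lt_le_trans e0 ele; have L0p := L0_gt0 ep.
  rewrite size_tuple add0n -(ler_nat R) => /le_trans; apply; rewrite /C ep.
  apply: num_queries_le => //; rewrite /L0 /log_factor.
  rewrite ler_ln ?posrE ?divr_gt0 ?mulr_gt0 //.
  by rewrite ler_wpM2l // lef_pV2 ?posrE ?mulr_gt0 // ler_wpM2l.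
- by move=> N _ w _; apply: card_stoch_bi_fold; rewrite cards0.
move=> N TN; rewrite /expect_draws /stoch_bi /returned card_draws_expn natrX.
have c0 : 0 < 'C(#|U|, m)%:R :> R by rewrite ltr0n bin_gt0 geq_minl.
rewrite ler_pdivlMr ?exprn_gt0 //.
(* A nonpositive logarithm means [eps >= 3 / 2], so [(1 - eps) * f OPT] is at most 0. *)
have [L_le0|L_gt0] := leP (log_factor eps) 0.
  have := log_factor_gt0 e0; rewrite ltNge L_le0 /= => /esym/negbT.
  rewrite -leNgt => e32; apply: (@le_trans _ _ 0).
    by rewrite mulr_le0_ge0 ?exprn_ge0 ?(ltW c0) // mulr_le0_ge0 //; lra.
  exact: sumr_ge0.
have [k0|k0] := posnP k.
  have OPT0 : OPT = set0 by apply/eqP; rewrite -cards_eq0 -leqn0 -k0.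
  apply: (@le_trans _ _ (f set0 * 'C(#|U|, m)%:R ^+ N)).
    rewrite ler_wpM2r ?exprn_ge0 ?(ltW c0) // OPT0 ler_piMl //; lra.
  rewrite -natrX -card_draws_expn mulr_natr -sumr_const; apply: ler_sum => w _.
  exact: (le_stoch_bi_fold pick k eps (set0, [::])).
have st0 : (#|(set0 : {set U}, [::] : seq {set U}).1| + T <= T)%N by rewrite cards0.
apply: le_trans (stoch_bi_fold_expect mf sf pf e0 L_gt0 k0 cOPT TN st0).
rewrite mulrC ler_wpM2l ?exprn_ge0 ?(ltW c0) //= mulrBl mul1r lerB //.
have := decay_le e0 L_gt0 k0 (le_natceil _); rewrite -/T.
set r := _ ^+ T => rle.
have r0 : 0 <= r.
  rewrite exprn_ge0 // subr_ge0 ler_pdivrMr ?ltr0n // mul1r.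
  by have : 1 <= k%:R :> R; [rewrite ler1n | lra].
(* The initial gap [f OPT - f set0] is at most [f OPT] because [f set0] is nonnegative. *)
apply: (@le_trans _ _ (r * f OPT)); last exact: ler_wpM2r.
by rewrite ler_wpM2l // gerBl.
Qed.
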